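(* For all integers $f \ge 1$ and all $k \ge 1$, there is a family of $n$-node weighted graphs $G$ (with $n$ arbitrarily large) such that every $f$-EFT $k$-spanner $H$ of $G$ has competitive lightness $$\ell_{f}(H \mid G) \geq \Omega\left( \frac{n}{f^2 k}\right).$$
   Context: Graphs $G=(V,E,w)$ have nonnegative edge weights; $w(H)$ denotes the total edge weight of a subgraph $H$, and $\mathrm{dist}_H$ the weighted shortest-path distance in $H$. An edge-subgraph $H$ of $G$ is an $f$-edge fault tolerant ($f$-EFT) $k$-spanner of $G$ if $\mathrm{dist}_{H\setminus F}(u,v)\le k\cdot \mathrm{dist}_{G\setminus F}(u,v)$ for all $u,v\in V$ and all $F\subseteq E$ with $|F|\le f$. A subgraph $Q\subseteq G$ is an $f$-EFT connectivity preserver of $G$ if for every $F\subseteq E$ with $|F|\le f$, the connected components of $Q\setminus F$ equal those of $G\setminus F$. Letting $T_f(G)$ be the set of all $f$-EFT connectivity preservers of $G$, the $f$-competitive lightness of a subgraph $H$ of $G$ is $\ell_f(H\mid G) := w(H)/\min_{Q\in T_f(G)} w(Q)$. *)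

(* Defs.v *)
From mathcomp Require Import all_boot all_order all_algebra.
From mathcomp Require Import classical_sets reals ereal.

Set Implicit Arguments.
Unset Strict Implicit.
Unset Printing Implicit Defensive.

Import Order.TTheory GRing.Theory Num.Theory.

Local Open Scope ring_scope.

(* A finite simple graph on V: an edge is the two-element set of its ends. *)
Record wgraph (R : realType) (V : finType) := WGraph {
  edges : {set {set V}};
  weight : {set V} -> R;
  edges_card2 : forall e, e \in edges -> #|e| = 2;
  weight_ge0 : forall e, e \in edges -> 0 <= weight e
}.

(* An edge-subgraph of G has all of V as its vertex set and is given by a
   subset of edges G; deleting the faults F from S is S :\: F. *)
Definition adj (V : finType) (S : {set {set V}}) : rel V :=
  fun u v => [set u; v]%SET \in S.

Definition components (V : finType) (S : {set {set V}}) : {set {set V}} :=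
  equivalence_partition (connect (adj S)) [set: V]%SET.

Section WeightedGraph.
Variables (R : realType) (V : finType) (G : wgraph R V).

Definition total_weight (S : {set {set V}}) : R := \sum_(e in S) weight G e.

Definition path_weight (u : V) (p : seq V) : R :=
  \sum_(e <- pairmap (fun x y => [set x; y]%SET) u p) weight G e.

Definition simple_path (S : {set {set V}}) (u v : V) (p : seq V) : bool :=
  [&& path (adj S) u p, last u p == v & uniq (u :: p)].

(* There are finitely many simple paths, so this is a minimum when u and v are
   connected in S, and +oo otherwise. *)
Definition dist (S : {set {set V}}) (u v : V) : \bar R :=
  ereal_inf [set (path_weight u p)%:E | p in [set p | simple_path S u v p]]%classic.

Definition eft_spanner (f : nat) (k : R) (H : {set {set V}}) : Prop :=
  H \subset edges G /\
  forall F : {set {set V}}, F \subset edges G -> (#|F| <= f)%N ->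
    forall u v : V, (dist (H :\: F) u v <= k%:E * dist (edges G :\: F) u v)%E.

Definition eft_preserver (f : nat) (Q : {set {set V}}) : bool :=
  (Q \subset edges G) &&
  [forall F : {set {set V}}, (F \subset edges G) && (#|F| <= f)%N ==>
     (components (Q :\: F) == components (edges G :\: F))].

Lemma edges_eft_preserver f : eft_preserver f (edges G).
Proof. by rewrite /eft_preserver subxx; apply/forallP=> F; apply/implyP. Qed.

(* edges G is only the witness that the set of preservers is nonempty. *)
Definition min_preserver_weight (f : nat) : R :=
  total_weight
    [arg min_(Q < edges G | eft_preserver f Q) total_weight Q]%O.

Lemma min_preserver_weightP f :
  (exists2 Q, eft_preserver f Q & min_preserver_weight f = total_weight Q) /\
  (forall Q, eft_preserver f Q -> min_preserver_weight f <= total_weight Q).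
Proof.
rewrite /min_preserver_weight.
case: arg_minP => [|Q pQ minQ]; first exact: edges_eft_preserver.
by split=> //; exists Q.
Qed.

(* When the minimum is 0 the quotient is 0, as x / 0 = 0 in R; a positive lower
   bound on it therefore entails that the minimum is positive. *)
Definition competitive_lightness (f : nat) (H : {set {set V}}) : R :=
  total_weight H / min_preserver_weight f.

End WeightedGraph.

(* Main.v *)
(** Arrange M+1 cliques of zero-weight edges in a ring, and join consecutive
    cliques by f edges of weight 1 and one heavy edge of weight M / (2k).
    Since f faults cannot disconnect two links of the ring, the unit and
    zero-weight edges alone form a preserver, of weight at most (M+1) f.
    But deleting the f unit edges of one link leaves its heavy edge as the only
    short connection: going around the ring costs at least M, which exceeds
    k times M / (2k).  So a spanner contains all M+1 heavy edges. *)

Require Import Defs.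
From mathcomp Require Import classical_sets constructive_ereal reals ereal.
From mathcomp Require Import all_boot all_order all_algebra.
From mathcomp Require Import zify ring lra.

Set Implicit Arguments.
Unset Strict Implicit.
Unset Printing Implicit Defensive.

Import Order.TTheory GRing.Theory Num.Theory.

Local Open Scope ring_scope.

(** * Edges as two-element sets, components, and pigeonhole *)

Section PairSets.
Variable T : finType.
Implicit Types (u v x y : T) (r : rel T).

Lemma set2_eq u v x y : [set u; v]%SET = [set x; y]%SET ->
  u = x /\ v = y \/ u = y /\ v = x.
Proof.
move=> E.
have := set21 u v; rewrite E !inE => ux.
have := set22 u v; rewrite E !inE => vx.
have := set21 x y; rewrite -E !inE => xu.
have := set22 x y; rewrite -E !inE => yu.
case/orP: ux => /eqP ux; subst u; [left|right]; split=> //.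
  by case/orP: vx => /eqP vx //; subst v; move: yu; rewrite orbb => /eqP.
by case/orP: vx => /eqP vx //; subst v; move: xu; rewrite orbb => /eqP.
Qed.

Definition pair_edges r : {set {set T}} :=
  [set [set p.1; p.2]%SET | p : T * T & (p.1 != p.2) && r p.1 p.2]%SET.

Lemma pair_edgesP r e :
  reflect (exists u v, [/\ e = [set u; v]%SET, u != v & r u v])
          (e \in pair_edges r).
Proof.
apply: (iffP imsetP) => [[[u v]]|[u [v [-> uv ruv]]]].
  by rewrite inE => /andP[/= uv ruv] ->; exists u, v.
by exists (u, v); rewrite // inE uv.
Qed.

Lemma mem_pair_edges r u v : symmetric r ->
  ([set u; v]%SET \in pair_edges r) = (u != v) && r u v.
Proof.
move=> sym_r; apply/pair_edgesP/andP => [[x [y [E xy rxy]]]|[uv ruv]].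
  by case: (set2_eq E) => -[-> ->]; rewrite // eq_sym sym_r.
by exists u, v.
Qed.

(** The ordering of the ends is picked arbitrarily, so the value is meaningful only for symmetric
    [g]; [a0] is a junk value for sets that are not of the form [[set x; y]]. *)
Definition pair_weight (A : Type) (a0 : A) (g : T -> T -> A) (e : {set T}) : A :=
  if [pick p : T * T | e == [set p.1; p.2]%SET] is Some p then g p.1 p.2 else a0.

Lemma pair_weightE (A : Type) (a0 : A) (g : T -> T -> A) u v :
  (forall x y, g x y = g y x) -> pair_weight a0 g [set u; v]%SET = g u v.
Proof.
move=> sym_g; rewrite /pair_weight; case: pickP => [[x y] /= /eqP /set2_eq|].
  by case=> -[-> ->].
by move/(_ (u, v)); rewrite eqxx.
Qed.

Lemma components_connected (S S' : {set {set T}}) : S \subset S' ->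
  (forall x y, connect (adj S) x y) -> components S = components S'.
Proof.
move=> sSS' conS.
have conS' x y : connect (adj S') x y.
  apply: connect_sub (conS x y) => u v uv; apply: connect1.
  by rewrite /adj (subsetP sSS').
apply: eq_in_imset => x _; apply/setP=> y.
by rewrite !inE conS conS'.
Qed.

Lemma adj_sym (S : {set {set T}}) : symmetric (adj S).
Proof. by move=> x y; rewrite /adj setUC. Qed.

Lemma components_connect (S S' : {set {set T}}) x y :
  components S = components S' -> connect (adj S) x y = connect (adj S') x y.
Proof.
have eqv (Z : {set {set T}}) :
    {in [set: T]%SET & &, equivalence_rel (connect (adj Z))}.
  move=> a b c _ _ _; split; first exact: connect0.
  by move=> ab; apply: same_connect => //; apply: sym_connect_sym; apply: adj_sym.
move=> E; rewrite -(pblock_equivalence_partition (eqv S)) ?inE //.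
by rewrite -(pblock_equivalence_partition (eqv S')) ?inE // -/(components S) E.
Qed.

(** Pigeonhole, used to find an edge that survives the faults [F]. *)
Lemma card_gt_exists_notin (I : finType) (F : {set {set T}}) (D : {set I})
    (g : I -> {set T}) : {in D &, injective g} -> (#|F| < #|D|)%N ->
  exists2 i, i \in D & g i \notin F.
Proof.
move=> inj_g ltFD; apply/exists_inP; rewrite -[X in is_true X]negbK.
apply/negP; rewrite negb_exists_in => /forall_inP allF.
have : g @: D \subset F.
  by apply/subsetP=> _ /imsetP[i iD ->]; have := allF i iD; rewrite negbK.
by move/subset_leq_card; rewrite card_in_imset // leqNgt ltFD.
Qed.

End PairSets.

(** * Walking around a cycle, and potentials along a path *)

Lemma val_ordS M (i : 'I_M.+1) :
  ordS i = (if (i : nat) == M then 0 else i.+1)%N :> nat.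
Proof.
rewrite /=; have := ltn_ord i; case: eqP => [->|ne] lt; first by rewrite modnn.
by rewrite modn_small //; lia.
Qed.

(** A cycle without one edge is still a path: [low] climbs from 0 to [i0], [high] from beyond [i0]
    to [M], and the wrap-around step from [M] to 0 joins the two. *)
Lemma cycle_minus_edge_total M (P : rel 'I_M.+1) (i0 : 'I_M.+1) :
  reflexive P -> symmetric P -> transitive P ->
  (forall i, i != i0 -> P i (ordS i)) -> forall i j, P i j.
Proof.
move=> rP sP tP step.
have low n : (n <= i0)%N -> P ord0 (inord n).
  elim: n => [|n IH] lt.
    by rewrite (_ : inord 0 = ord0) //; apply/val_inj; rewrite /= inordK.
  have := ltn_ord i0; move=> ltM.
  apply: tP (IH _) _; first by lia.
  have -> : inord n.+1 = ordS (inord n) :> 'I_M.+1.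
    by apply/ord_inj; rewrite val_ordS /= !inordK; try lia; case: eqP => //; lia.
  by apply: step; apply/eqP => /(congr1 val); rewrite /= inordK; lia.
have high n : (n <= M - i0.+1)%N -> (i0 < M)%N -> P (inord (M - n)) ord_max.
  elim: n => [|n IH] le lt.
    by rewrite (_ : inord _ = ord_max) //; apply/val_inj; rewrite /= inordK; lia.
  apply: tP (IH _ _); try lia.
  have -> : inord (M - n) = ordS (inord (M - n.+1)) :> 'I_M.+1.
    apply/ord_inj; rewrite val_ordS /= !inordK; try lia.
    by case: eqP => //; lia.
  by apply: step; apply/eqP => /(congr1 val); rewrite /= inordK; lia.
suff H0 i : P ord0 i by move=> i j; apply: tP (H0 j); rewrite sP.
have lti := ltn_ord i.
case: (leqP i i0) => [le|lt]; first by rewrite -[i]inord_val; exact: low.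
have := high (M - i)%N.
rewrite subKn; last by lia.
rewrite inord_val => /(_ ltac:(lia) ltac:(lia)) iM.
rewrite sP; apply: tP iM _.
have -> : ord0 = ordS ord_max :> 'I_M.+1.
  by apply/ord_inj; rewrite val_ordS /= eqxx.
by apply: step; apply/eqP => /(congr1 val) /=; lia.
Qed.

(** Telescoping along the path. A potential [phi] thus certifies lower bounds on distances. *)
Lemma path_weight_ge (R : realType) (V : finType) (G : wgraph R V)
    (S : {set {set V}}) (phi : V -> R) (u : V) (p : seq V) :
  (forall x y, adj S x y -> phi x <= phi y + weight G [set x; y]%SET) ->
  path (adj S) u p -> phi u <= phi (last u p) + path_weight G u p.
Proof.
move=> Hphi; rewrite /path_weight.
elim: p u => [|v p IH] u /=; first by rewrite big_nil addr0.
case/andP=> /Hphi uv /IH; rewrite big_cons; lra.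
Qed.

(** * The ring of cliques and its links *)

Section RingOfCliques.
Variables (R : realType) (M f : nat) (w : R).
Hypotheses (M_gt1 : (1 < M)%N) (f_gt0 : (0 < f)%N) (w_ge1 : 1 <= w).

Let V : finType := ('I_M.+1 * 'I_f.+2)%type.
Implicit Types (x y : V) (i j : 'I_M.+1).

(* Rows below f carry the unit links and row f the heavy link; row f.+1 has no
   link and only makes the cliques (f+1)-edge-connected. *)
Definition ring_rel : rel V := fun x y =>
  (x.1 == y.1) ||
  [&& x.2 == y.2, (x.2 <= f)%N & (y.1 == ordS x.1) || (x.1 == ordS y.1)].

(** Testing both rows makes symmetry immediate; the two ends of a link lie in the same row
    anyway. *)
Definition ring_wt x y : R :=
  if x.1 == y.1 then 0
  else if (x.2 == f :> nat) && (y.2 == f :> nat) then w else 1.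

Lemma ring_rel_sym : symmetric ring_rel.
Proof.
move=> x y; rewrite /ring_rel eq_sym; congr (_ || _).
by rewrite eq_sym; case: eqP => //= ->; rewrite orbC.
Qed.

Lemma ring_wt_sym x y : ring_wt x y = ring_wt y x.
Proof. by rewrite /ring_wt eq_sym andbC. Qed.

Lemma ring_wt_ge0 x y : 0 <= ring_wt x y.
Proof.
by rewrite /ring_wt; case: ifP => // _; case: ifP => // _; apply: le_trans w_ge1.
Qed.

Lemma ring_wt_ge1 x y : x.1 != y.1 -> 1 <= ring_wt x y.
Proof. by rewrite /ring_wt => /negbTE->; case: ifP. Qed.

Lemma ring_edges_card2 e : e \in pair_edges ring_rel -> #|e| = 2.
Proof. by case/pair_edgesP=> u [v [-> uv _]]; rewrite cards2 uv. Qed.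

Lemma ring_weight_ge0 e :
  e \in pair_edges ring_rel -> 0 <= pair_weight 0 ring_wt e.
Proof.
case/pair_edgesP=> u [v [-> _ _]]; rewrite pair_weightE ?ring_wt_ge0 //.
exact: ring_wt_sym.
Qed.

Definition ring_graph : wgraph R V := WGraph ring_edges_card2 ring_weight_ge0.

Lemma ring_weightE x y : weight ring_graph [set x; y]%SET = ring_wt x y.
Proof. exact/pair_weightE/ring_wt_sym. Qed.

Lemma mem_ring_edges x y :
  ([set x; y]%SET \in edges ring_graph) = (x != y) && ring_rel x y.
Proof. exact/mem_pair_edges/ring_rel_sym. Qed.

Definition link_edge i (a : nat) : {set V} :=
  [set (i, inord a); (ordS i, inord a)]%SET.

Lemma ordS_neq i : ordS i != i.
Proof. by apply/eqP => /(congr1 (@nat_of_ord _)); rewrite val_ordS; case: eqP; lia. Qed.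

Lemma ordS2_neq i : ordS (ordS i) != i.
Proof.
apply/eqP => /(congr1 (@nat_of_ord _)); rewrite !val_ordS.
by have := ltn_ord i; do 2!case: eqP; lia.
Qed.

(** If the ends matched crosswise, two steps around the ring would return to [j], which a ring of at
    least three cliques excludes. *)
Lemma link_edge_inj i j (a b : nat) : (a < f.+2)%N -> (b < f.+2)%N ->
  link_edge i a = link_edge j b -> i = j /\ a = b.
Proof.
move=> lta ltb /set2_eq[] [] [ij ab] [Sij _].
  by split=> //; move/(congr1 val): ab; rewrite /= !inordK.
by have := ordS2_neq j; rewrite -ij Sij eqxx.
Qed.

Lemma link_edge_in i a : (a <= f)%N -> link_edge i a \in edges ring_graph.
Proof.
move=> le; rewrite mem_ring_edges /ring_rel /= !eqxx inordK ?ltnS ?leqW //.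
rewrite le orbT andbT.
by apply: contra (ordS_neq i) => /eqP[{2}->].
Qed.

Lemma link_edge_weight i a : (a <= f)%N ->
  weight ring_graph (link_edge i a) = if a == f then w else 1.
Proof.
move=> le; rewrite ring_weightE /ring_wt /= eq_sym (negbTE (ordS_neq i)).
by rewrite inordK ?ltnS ?leqW // andbb.
Qed.

Definition heavy_edges : {set {set V}} := [set link_edge i f | i : 'I_M.+1]%SET.

Definition cheap : {set {set V}} := edges ring_graph :\: heavy_edges.

Lemma clique_edge_cheap i (a b : 'I_f.+2) : a != b ->
  [set (i, a); (i, b)]%SET \in cheap.
Proof.
move=> ab; rewrite inE mem_ring_edges /ring_rel /= eqxx andbT; apply/andP; split.
  apply/negP => /imsetP[j _] /set2_eq[] [[ij _] [ij' _]];
  by have /eqP := ordS_neq j; congruence.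
by apply: contra ab => /eqP[->].
Qed.

Lemma light_edge_cheap i a : (a < f)%N -> link_edge i a \in cheap.
Proof.
move=> lt; rewrite inE link_edge_in ?(ltnW lt) // andbT.
apply/negP => /imsetP[j _] /link_edge_inj []; lia.
Qed.

(** * Connectivity of the cheap edges under faults *)

Section Faults.
Variable F : {set {set V}}.
Hypothesis F_small : (#|F| <= f)%N.

Let con := connect (adj (cheap :\: F)).

Let con_sym : symmetric con.
Proof. exact/sym_connect_sym/adj_sym. Qed.

Lemma clique_connected i (a b : 'I_f.+2) : con (i, a) (i, b).
Proof.
have [->|ab] := eqVneq a b; first exact: connect0.
(* The f+1 routes from [a] to [b] through some [c != a] are edge-disjoint, [c = b] being the direct
   edge. [g c] is the first edge of the route if that is faulty and the second otherwise, so [g c]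
   outside [F] means that the route survives. *)
pose g (c : 'I_f.+2) : {set V} := if [set (i, a); (i, c)]%SET \in F
  then [set (i, a); (i, c)]%SET else [set (i, c); (i, b)]%SET.
have [||c] := @card_gt_exists_notin _ _ F [set~ a]%SET g.
- move=> c d; rewrite !inE => /eqP ca /eqP da; rewrite /g; move/eqP: ab => ab.
  by case: ifP => _; case: ifP => _ /set2_eq[] []; congruence.
- by rewrite cardsC1 card_ord /= ltnS.
rewrite !inE => ca; rewrite /g; case: ifP => [->//|acF cbF].
have con_ac : con (i, a) (i, c).
  by apply: connect1; rewrite /adj inE acF clique_edge_cheap // eq_sym.
have [<-//|cb] := eqVneq c b.
apply: connect_trans con_ac (connect1 _).
by rewrite /adj inE cbF clique_edge_cheap.
Qed.

Definition open_link i := [exists a : 'I_f, link_edge i a \notin F].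

(** Two distinct closed links would take 2f faults, more than f. *)
Lemma closed_link_unique i j : ~~ open_link i -> ~~ open_link j -> i = j.
Proof.
rewrite !negb_exists => /forallP ci /forallP cj; apply/eqP/negPn/negP => ij.
pose g (p : bool * 'I_f) := link_edge (if p.1 then i else j) p.2.
have [||[[] a] _] := @card_gt_exists_notin _ _ F [set: bool * 'I_f]%SET g.
- move=> [b a] [d c] _ _ /link_edge_inj /=.
  have := ltn_ord a; have := ltn_ord c; move=> ltc lta [| |e /val_inj ->]; try lia.
  by case: b d e => [] [] // e; rewrite e eqxx in ij.
- by rewrite cardsT card_prod card_bool card_ord; lia.
- exact/negP/ci.
- exact/negP/cj.
Qed.

Lemma cheap_connected x y : con x y.
Proof.
have colP i a b := clique_connected i a b.
have step i : open_link i -> con (i, ord0) (ordS i, ord0).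
  case/existsP=> a aF; apply: connect_trans (colP i ord0 (inord a)) _.
  apply: connect_trans (colP _ (inord a) ord0); apply: connect1.
  by rewrite /adj inE -/(link_edge i a) aF light_edge_cheap.
pose P i j := con (i, ord0) (j, ord0).
suff HP i j : P i j.
  case: x y => [i a] [j b]; apply: connect_trans (colP i a ord0) _.
  exact: connect_trans (HP i j) (colP j ord0 b).
(* [i0] is the closed link if there is one, and arbitrary otherwise. *)
have [i0 Hi0] : exists i0, forall i, i != i0 -> open_link i.
  case: (pickP (fun i => ~~ open_link i)) => [i0 ci0|none]; last first.
    by exists ord0 => k _; have := none k => /negbFE.
  exists i0 => k; apply: contraR => ck; apply/eqP; exact: closed_link_unique.
apply: (@cycle_minus_edge_total _ P i0) => [k|k l|k l m|k /Hi0 /step //].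
- exact: connect0.
- exact: con_sym.
- exact: connect_trans.
Qed.

End Faults.

(** * Bounds on the weight of preservers *)

Lemma cheap_preserver : eft_preserver ring_graph f cheap.
Proof.
rewrite /eft_preserver subsetDl; apply/forallP => F; apply/implyP=> /andP[_ leF].
apply/eqP/components_connected; first exact/setSD/subsetDl.
by move=> x y; exact: cheap_connected.
Qed.

Lemma cheap_weight : total_weight ring_graph cheap <= (M.+1 * f)%:R.
Proof.
pose L : {set {set V}} := [set link_edge p.1 p.2 | p : 'I_M.+1 * 'I_f]%SET.
have leL : (#|L| <= M.+1 * f)%N.
  by apply: leq_trans (leq_imset_card _ _) _; rewrite cardT -cardE card_prod !card_ord.
apply: (@le_trans _ _ #|L|%:R); last by rewrite ler_nat.
have -> : #|L|%:R = \sum_(e in L) (1 : R) by rewrite sumr_const.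
(* Termwise comparison with the indicator of [L]: a clique edge weighs 0, and every other cheap edge
   is a unit link, hence in [L]. *)
rewrite /total_weight big_mkcond [leRHS]big_mkcond; apply: ler_sum => e _.
case: ifP => [|_]; last by case: ifP.
rewrite inE => /andP[nH /pair_edgesP[x [y [E xy rxy]]]]; subst e.
rewrite ring_weightE /ring_wt; case: ifP => xy1; first by case: ifP.
move: rxy; rewrite /ring_rel xy1 /= => /and3P[/eqP e2 le lk].
have Exy : exists i, [set x; y]%SET = link_edge i x.2.
  case: x y e2 {nH xy xy1 le} lk => [i a] [j b] /= <- /orP[] /eqP->.
    by exists i; rewrite /link_edge inord_val.
  by exists j; rewrite /link_edge inord_val setUC.
case: Exy nH => i -> nH.
have neq : (x.2 : nat) != f.
  by apply: contra nH => /eqP->; apply/imsetP; exists i.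
rewrite (negbTE neq) /= ifT //; apply/imsetP.
have lt : (x.2 < f)%N by rewrite ltn_neqAle neq.
by exists (i, Ordinal lt).
Qed.

(** A preserver of weight 0 has only clique edges and never leaves a clique, yet without faults it
    must connect different cliques. This keeps the lightness from being a division by 0. *)
Lemma preserver_weight_gt0 Q :
  eft_preserver ring_graph f Q -> 0 < total_weight ring_graph Q.
Proof.
case/andP=> /subsetP sQ /forallP /(_ set0); rewrite sub0set cards0 /= !setD0.
move=> /eqP compQ; rewrite lt_def sumr_ge0 ?andbT; last first.
  by move=> e /sQ; exact: weight_ge0.
apply/negP => /eqP/psumr_eq0P w0.
have {}w0 := w0 (fun e eQ => weight_ge0 (sQ e eQ)).
have same_col : closed (adj Q) [pred x : V | x.1 == ord0].
  move=> x y xyQ; rewrite !inE; congr (_ == _); apply/eqP/negPn/negP => xy.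
  by have := ring_wt_ge1 xy; rewrite -ring_weightE w0 // ler10.
pose u : V := (ord0, ord0); pose v : V := (ordS ord0, ord0).
have conuv : connect (adj Q) u v.
  rewrite (components_connect _ _ compQ).
  have := @cheap_connected set0; rewrite cards0 setD0 => /(_ isT u v).
  apply: connect_sub => x y xy; apply: connect1.
  by move: xy; rewrite /adj inE => /andP[].
have := closed_connect same_col conuv.
by rewrite !inE eqxx (negbTE (ordS_neq _)).
Qed.

(** * Lower bound on the weight and lightness of spanners *)

Lemma heavy_edge_in_spanner (k : R) (H : {set {set V}}) i :
  0 <= k -> k * w < M%:R -> eft_spanner ring_graph f k H -> link_edge i f \in H.
Proof.
move=> k_ge0 kw [/subsetP sH spanH]; apply/negPn/negP => niH.
pose F : {set {set V}} := [set link_edge i a | a : 'I_f]%SET.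
have sF : F \subset edges ring_graph.
  by apply/subsetP=> _ /imsetP[a _ ->]; rewrite link_edge_in // ltnW.
have cF : (#|F| <= f)%N.
  by apply: leq_trans (leq_imset_card _ _) _; rewrite cardT -cardE card_ord.
pose u : V := (i, inord f); pose v : V := (ordS i, inord f).
have uv : u != v by apply: contra (ordS_neq i) => /eqP[{2}->].
have dG : (dist ring_graph (edges ring_graph :\: F) u v <= w%:E)%E.
  apply: ereal_inf_lbound; exists [:: v].
    rewrite /= /simple_path /= eqxx !andbT inE uv !andbT.
    rewrite /adj inE -/(link_edge i f) link_edge_in // andbT.
    apply/negP => /imsetP[a _] /link_edge_inj; have := ltn_ord a; lia.
  by rewrite /path_weight big_cons big_nil addr0 link_edge_weight // eqxx.
(* Position along the cycle cut open at link i. *)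
pose phi x : R := (if (i < x.1)%N then x.1 : nat else x.1 + M.+1)%N%:R.
have dH : (M%:R%:E <= dist ring_graph (H :\: F) u v)%E.
  apply: le_ereal_inf_tmp => _ [p /and3P[pth /eqP lst _] <-].
  rewrite lee_fin.
  suff Hphi : forall x y, adj (H :\: F) x y ->
                phi x <= phi y + weight ring_graph [set x; y]%SET.
    have := path_weight_ge Hphi pth; rewrite lst => le.
    (* If [i = M], then [v] lies in column 0 and has potential M+1 rather than 0, so the difference
       is M in both cases. *)
    have : phi u = phi v + M%:R; last by lra.
    rewrite /phi /u /v ltnn -natrD val_ordS /=; congr _%:R.
    by case: eqP; case: ltnP; have := ltn_ord i; lia.
  move=> x y; rewrite /adj inE => /andP[nF xyH]; rewrite ring_weightE.
  have := sH _ xyH; rewrite mem_ring_edges => /andP[xy rxy].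
  have [e1|ne1] := eqVneq x.1 y.1.
    by rewrite /phi e1 lerDl ring_wt_ge0.
  (* Every link weighs at least 1, so it suffices that [phi] drops by at most 1 along each surviving
     link. *)
  apply: (@le_trans _ _ (phi y + 1)); last by rewrite lerD2l ring_wt_ge1.
  rewrite /phi natr1 ler_nat.
  move: rxy; rewrite /ring_rel (negbTE ne1) /= => /and3P[/eqP e2 le lk].
  (* No surviving edge of [H] crosses the cut, where [phi] jumps by M: the heavy edge of link [i] is
     missing from [H] and its unit edges are in [F]. *)
  have not_i j (a : 'I_f.+2) : (a <= f)%N ->
      link_edge j a \in H -> link_edge j a \notin F -> j != i.
    move=> lea inH; apply: contra => /eqP ji; subst j.
    have [af|naf] := eqVneq (a : nat) f; first by rewrite af (negbTE niH) in inH.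
    have lt : (a < f)%N by rewrite ltn_neqAle naf.
    by apply/imsetP; exists (Ordinal lt).
  case: x y e2 le lk {xy ne1} nF xyH => [j a] [l b] /= <- le
    /orP[] /eqP-> nF xyH.
    have ji : (j : nat) != i.
      by apply: (not_i j a le); rewrite /link_edge inord_val.
    rewrite val_ordS; move: ji (ltn_ord i) (ltn_ord j) => ji lti ltj.
    by case: eqP => ?; do 2!case: (ltnP i _) => ?; lia.
  have li : (l : nat) != i.
    by apply: (not_i l a le); rewrite /link_edge inord_val setUC.
  rewrite val_ordS; move: li (ltn_ord i) (ltn_ord l) => li lti ltl.
  by case: eqP => ?; do 2!case: (ltnP i _) => ?; lia.
have := spanH F sF cF u v => le.
have : (M%:R%:E <= k%:E * w%:E)%E.
  by apply: le_trans dH (le_trans le _); apply: lee_wpmul2l; rewrite ?lee_fin.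
by rewrite -EFinM lee_fin leNgt kw.
Qed.

Lemma spanner_weight (k : R) (H : {set {set V}}) :
  0 <= k -> k * w < M%:R -> eft_spanner ring_graph f k H ->
  M.+1%:R * w <= total_weight ring_graph H.
Proof.
move=> k_ge0 kw spanH.
have card_heavy : #|heavy_edges| = M.+1.
  by rewrite card_imset ?card_ord // => i j /link_edge_inj[].
have sHH : heavy_edges \subset H.
  by apply/subsetP=> _ /imsetP[i _ ->]; exact: heavy_edge_in_spanner spanH.
have -> : M.+1%:R * w = total_weight ring_graph heavy_edges.
  rewrite /total_weight (eq_bigr (fun=> w)) => [|_ /imsetP[i _ ->]].
    by rewrite sumr_const card_heavy mulr_natl.
  by rewrite link_edge_weight // eqxx.
rewrite /total_weight [leRHS](big_setID heavy_edges) /=.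
rewrite (setIidPr sHH) lerDl; apply: sumr_ge0 => e.
by rewrite inE => /andP[_ eH]; apply: (@weight_ge0 _ _ ring_graph); apply: (subsetP spanH.1).
Qed.

Lemma spanner_lightness (k : R) (H : {set {set V}}) :
  0 <= k -> k * w < M%:R -> eft_spanner ring_graph f k H ->
  w / f%:R <= competitive_lightness ring_graph f H.
Proof.
move=> k_ge0 kw spanH; rewrite /competitive_lightness.
have [[Q presQ eqQ] minQ] := min_preserver_weightP ring_graph f.
have m_gt0 : 0 < min_preserver_weight ring_graph f.
  by rewrite eqQ preserver_weight_gt0.
have m_le := le_trans (minQ _ cheap_preserver) cheap_weight.
rewrite ler_pdivlMr //; apply: le_trans (spanner_weight k_ge0 kw spanH).
(* The factor M+1 is common to the spanner and preserver bounds and cancels. *)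
apply: (@le_trans _ _ (w / f%:R * (M.+1 * f)%:R)).
  by apply: ler_wpM2l => //; rewrite divr_ge0 ?ler0n // (le_trans _ w_ge1).
rewrite natrM mulrCA mulfVK // pnatr_eq0; lia.
Qed.

End RingOfCliques.

(** * Choice of the parameters *)

Theorem theorem1p9 (R : realType) :
  exists c : R, 0 < c /\
  forall (f : nat) (k : R), (1 <= f)%N -> 1 <= k ->
  forall N : nat, exists (V : finType) (G : wgraph R V),
    (N <= #|V|)%N /\
    forall H : {set {set V}}, eft_spanner G f k H ->
      c * (#|V|%:R / (f%:R ^+ 2 * k)) <= competitive_lightness G f H.
Proof.
(* 1/12 is the factor 1/2 in [w] times 1/6 from the vertex count (M+1)(f+2) <= 2M * 3f. *)
exists 12^-1; split; first by rewrite invr_gt0.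
move=> f k f_gt0 k_ge1 N.
have k_gt0 : 0 < k by apply: lt_le_trans k_ge1.
(* The [truncn] term gives M > 2k, hence [w >= 1], so that heavy links on a detour also cost at
   least 1; [N] makes the graph large. *)
pose M := (Num.truncn (2 * k) + N).+2.
have M_gt1 : (1 < M)%N by [].
have M_gt0 : 0 < M%:R :> R by rewrite ltr0n.
(* The 2 makes [k * w] equal to M/2, strictly below the detour cost M. *)
pose w := M%:R / (2 * k).
have w_ge1 : 1 <= w.
  rewrite ler_pdivlMr ?mul1r ?mulr_gt0 //; apply/ltW.
  apply: lt_le_trans (truncnS_gt (2 * k)) _; by rewrite ler_nat ltnS leqW ?leq_addr.
have kw : k * w < M%:R.
  have -> : k * w = M%:R / 2 by rewrite /w; field; rewrite gt_eqF.
  lra.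
exists _, (ring_graph M f w_ge1); rewrite card_prod !card_ord; split.
  by rewrite /M; nia.
move=> H spanH.
apply: le_trans (spanner_lightness M_gt1 f_gt0 (ltW k_gt0) kw spanH).
have f0 : 0 < f%:R :> R by rewrite ltr0n.
have -> : w / f%:R = 12^-1 * ((6 * M * f)%:R / (f%:R ^+ 2 * k)).
  by rewrite !natrM /w; field; rewrite !gt_eqF.
apply: ler_wpM2l; first by rewrite invr_ge0.
apply: ler_wpM2r; first by rewrite invr_ge0 mulr_ge0 ?exprn_ge0 ?ltW.
rewrite ler_nat; nia.
Qed.
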